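(* Let $G=(V,E)$ be a connected, locally finite infinite network with conductance function $c:E\to\mathbb{R}_+$ and base point $o\in V$, let $\mathscr{H}$ be its energy Hilbert space and let $R^{(c)}:V\times V\to\mathbb{R}_+$ be its resistance metric. Let $M$ be the metric completion of $(V,R^{(c)})$. Then: (i) For every $f\in\mathscr{H}$, the function $V\ni x\mapsto f(x)\in\mathbb{C}$ extends by closure to a uniformly continuous function $\widetilde{f}:M\to\mathbb{C}$. (ii) If $R^{(c)}$ is assumed bounded, then the reproducing kernel Hilbert space $\mathscr{H}$ is an algebra under the pointwise product $(f_1f_2)(x)=f_1(x)f_2(x)$, $f_i\in\mathscr{H}$, $i=1,2$, $x\in V$. (iii) If $M$ is compact, then $\{\widetilde{f} : f\in\mathscr{H}\}$ is dense in $C(M)$ in the uniform norm.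
   Context: Setting. $V$ is a countably infinite set, $E\subset V\times V\setminus(\text{diagonal})$ is symmetric, and the conductance function $c:E\to\mathbb{R}_+$ (conductance = 1/resistance, so $c>0$ on $E$) satisfies $c_{xy}=c_{yx}$. Write $y\sim x$ if $(x,y)\in E$. Each $x\in V$ has only finitely many neighbors. A base point $o\in V$ is fixed, and $G$ is connected: for every $x\in V\setminus\{o\}$ there are edges $(x_i,x_{i+1})\in E$, $0\le i\le n-1$, with $x_0=o$, $x_n=x$. The energy Hilbert space $\mathscr{H}$ consists of all functions $f:V\to\mathbb{C}$ with $f(o)=0$ and $\|f\|_{\mathscr{H}}^2=\frac12\sum_{(x,y)\in E}c_{xy}|f(x)-f(y)|^2<\infty$, with inner product $\langle h,f\rangle_{\mathscr{H}}=\frac12\sum_{(x,y)\in E}c_{xy}(\overline{h(x)}-\overline{h(y)})(f(x)-f(y))$. For each $x\in V$ the dipole $v_x\in\mathscr{H}$ is the vector with $\langle v_x,f\rangle_{\mathscr{H}}=f(x)-f(o)$ for all $f\in\mathscr{H}$ (so $v_o=0$); $\mathscr{H}$ is the reproducing kernel Hilbert space of the kernel $k^{(c)}(x,y)=\langle v_x,v_y\rangle_{\mathscr{H}}$. The resistance metric is $R^{(c)}(x,y)=\|v_x-v_y\|_{\mathscr{H}}^2$. $C(M)$ is the space of continuous complex-valued functions on $M$.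
   Formalization: In (iii), density in all of C(M) fails because every f in the energy space has f(o)=0, so the constant 1 cannot be approximated; the formal claim is that the uniform closure is exactly the set of continuous functions on M vanishing at o. *)

(* Defs.v *)
From HB Require Import structures.
From mathcomp Require Export all_boot all_order all_algebra.
From mathcomp Require Export complex.
From mathcomp Require Export all_classical all_reals all_analysis.

Set Implicit Arguments.
Unset Strict Implicit.
Unset Printing Implicit Defensive.

Export Order.TTheory GRing.Theory Num.Theory.
Export numFieldNormedType.Exports.

#[export] Set Implicit Arguments.
#[export] Unset Strict Implicit.
#[export] Unset Printing Implicit Defensive.

Local Open Scope classical_set_scope.
Local Open Scope ring_scope.

(* The conductance is a total function on V * V, but only its values on edges
   are constrained here or used below. *)
Record network (R : realType) (V : countType) (E : rel V) (c : V -> V -> R)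
    (o : V) : Prop := Network {
  network_infinite : infinite_set [set: V];
  network_irr : forall x, ~~ E x x;
  network_sym : forall x y, E x y -> E y x;
  network_cond_gt0 : forall x y, E x y -> 0 < c x y;
  network_cond_sym : forall x y, E x y -> c x y = c y x;
  network_locally_finite : forall x, finite_set [set y | E x y];
  network_connected : forall x, x != o ->
    exists p : seq V, path E o p /\ last o p = x }.

(* Sum of an absolutely summable family over a set, as the difference of the
   sums of the positive and negative parts ([\esum] is meant for nonnegative
   families). *)
Definition rsum (R : realType) (T : choiceType) (D : set T) (a : T -> R) : R :=
  fine (\esum_(i in D) (Num.max (a i) 0)%:E)
  - fine (\esum_(i in D) (Num.max (- a i) 0)%:E).

Definition csum (R : realType) (T : choiceType) (D : set T) (a : T -> R[i]) :
    R[i] :=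
  Complex (rsum D (fun i => complex.Re (a i))) (rsum D (fun i => complex.Im (a i))).

Section energy.
Variables (R : realType) (V : countType) (E : rel V) (c : V -> V -> R) (o : V).
Implicit Types f h : V -> R[i].

Definition edges : set (V * V) := [set e | E e.1 e.2].

(* The squared energy norm, [+oo] when the energy is infinite. *)
Definition energy f : \bar R :=
  ((2^-1)%:E *
   \esum_(e in edges) (c e.1 e.2 * Normc.normc (f e.1 - f e.2) ^+ 2)%:E)%E.

Definition energy_space : set (V -> R[i]) :=
  [set f | f o = 0 /\ (energy f < +oo)%E].

(* The family is absolutely summable whenever h and f have finite energy. *)
Definition energy_inner h f : R[i] :=
  2^-1 * csum edges (fun e =>
    (c e.1 e.2)%:C%C * (conjc (h e.1) - conjc (h e.2)) * (f e.1 - f e.2)).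

Definition is_dipole (x : V) (v : V -> R[i]) : Prop :=
  energy_space v /\
  forall f, energy_space f -> energy_inner v f = f x - f o.

(* On a network the dipole exists and is unique, by Riesz representation; the
   default value of [xget] is then never used. *)
Definition dipole (x : V) : V -> R[i] := xget (fun=> 0) (is_dipole x).

Definition resistance (x y : V) : R :=
  fine (energy (fun z => dipole x z - dipole y z)).

End energy.

(* [iota] exhibits the metric space M as the metric completion of (X, d); this
   determines M up to a unique isometry commuting with the embeddings. *)
Definition is_completion (R : realType) (X : Type) (d : X -> X -> R)
    (M : metricType R) (iota : X -> M) : Prop :=
  [/\ forall x y, mdist (iota x) (iota y) = d x y,
      dense (range iota) &
      forall F : set_system M, ProperFilter F -> cauchy F -> exists l : M, F --> l].

(* [ft] is the extension by closure of [f]: it restricts to [f], and its graph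
   is the closure of the graph of [f]. The carrier of the complex numbers is
   [R[i]^o], the alias which bears the topology. *)
Definition extends_by_closure (R : realType) (X : Type) (M : metricType R)
    (iota : X -> M) (f : X -> R[i]) (ft : M -> R[i]^o) : Prop :=
  (forall x, ft (iota x) = f x) /\
  [set q : M * R[i]^o | ft q.1 = q.2] =
    closure (range (fun x => (iota x, f x) : M * R[i]^o)).

Definition pointwise_algebra (R : realType) (X : Type)
    (A : set (X -> R[i])) : Prop :=
  [/\ A (fun=> 0),
      forall f g, A f -> A g -> A (fun x => f x + g x),
      forall (a : R[i]) f, A f -> A (fun x => a * f x) &
      forall f g, A f -> A g -> A (fun x => f x * g x)].

Definition extension_set (R : realType) (X : Type) (M : metricType R)
    (iota : X -> M) (A : set (X -> R[i])) : set (M -> R[i]^o) :=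
  [set ft | exists2 f, A f & extends_by_closure iota f ft].

(* Main.v *)
Require Import Defs.
From mathcomp Require Import ring lra.

Local Open Scope classical_set_scope.
Local Open Scope ring_scope.
Import Normc.

(** The real and imaginary parts separate the complex energy space into two
    copies of the space of real functions [u] with [u o = 0] and finite
    Dirichlet form, so that everything is done for real functions.

    The first point is that the dipoles exist, since [resistance] is defined
    through them.  For [x != o] a function of least energy among those with
    value 1 at [x] exists: by the parallelogram law a minimizing sequence is
    Cauchy for the energy, hence pointwise Cauchy because evaluations are
    bounded along paths from [o] ([point_bound]), and the energy is lower
    semicontinuous for pointwise limits ([energy_lsc]).  The first variation
    makes the minimizer a multiple of the dipole ([real_dipole_exists]).
    Cauchy-Schwarz then gives ([energy_resistance])
      (u x - u y)^2 <= (energy of u) * (resistance x y).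

    (i) By this inequality every real function of finite energy is Hoelder
    continuous of exponent 1/2 for the resistance metric.  McShane's formula
    inf_x (u x + w (x, p)), where w is the square root of a multiple of the
    distance, extends it to the completion with the same modulus
    ([holder_extension]).

    (ii) If the resistance is bounded, then so is every function of finite
    energy, and the increments of a product are dominated by those of its
    factors ([dominated_finite_energy]).

    (iii) Finite energy is also preserved by pointwise maxima, so the lattice
    form of the Stone-Weierstrass theorem ([kakutani_stone]) applies to
    the real functions on the completion which extend functions of finite
    energy.  These separate points: for [p != q] take [x] near [p] and [y] near
    [q]; the difference of the dipoles at [x] and [y] has energy and increment
    both equal to the resistance [r] from [x] to [y], while its oscillation near
    [p] and [q] is small compared with [r].  Interpolation at two points
    other than the base point follows by multiplication, the functions being
    bounded on a compact space.  Since all of them vanish at the base point,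
    their uniform closure consists of the continuous functions vanishing there. *)

(** * Linearity of sums of absolutely summable families *)

Section rsum_theory.
Variables (R : realType) (T : choiceType) (D : set T).
Implicit Types a b p q : T -> R.

Local Notation asummable a := (summable D (EFin \o a)).

Lemma le_summable a b : (forall i, D i -> `|a i| <= `|b i|) ->
  asummable b -> asummable a.
Proof.
move=> ab; apply: le_lt_trans; apply: le_esum => i Di /=.
by rewrite lee_fin ab.
Qed.

Lemma asummableD a b : asummable a -> asummable b ->
  asummable (fun i => a i + b i).
Proof. exact: summableD. Qed.

Lemma asummableN a : asummable a -> asummable (fun i => - a i).
Proof. by apply: le_summable => i _; rewrite normrN. Qed.

(** Stated for absolute values because distributing a factor over a finite sum of
    extended reals asks for nonnegative terms everywhere, not only on [D]. *)
Lemma esum_normZ a (k : R) : 0 <= k ->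
  (\esum_(i in D) (k * `|a i|)%:E = k%:E * \esum_(i in D) `|a i|%:E)%E.
Proof.
have le_esumZ (l : R) (b : T -> R) : 0 <= l ->
    (\esum_(i in D) (l * `|b i|)%:E <= l%:E * \esum_(i in D) `|b i|%:E)%E.
  move=> l0; apply: ge_ereal_sup => _ [X [finX XD] <-].
  under eq_fsbigr do rewrite EFinM.
  rewrite -ge0_mule_fsumr; last by move=> i; rewrite lee_fin.
  rewrite lee_wpmul2l ?lee_fin//.
  by apply: esum_ge; exists X.
rewrite le_eqVlt => /predU1P[<-|k0].
  by rewrite mul0e esum1// => i _; rewrite mul0r.
apply/eqP; rewrite eq_le le_esumZ/=; last exact: ltW.
rewrite -lee_pdivlMl//.
rewrite (@eq_esum _ _ _ (fun i => (k * `|a i|)%:E) (fun i => `|k * a i|%:E)).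
  apply: le_trans (le_esumZ k^-1 (fun i => k * a i) _); last first.
    by rewrite invr_ge0 ltW.
  by apply: le_esum => i _; rewrite lee_fin normrM gtr0_norm// mulKf// gt_eqF.
by move=> i _; rewrite normrM gtr0_norm.
Qed.

Lemma asummableZ (k : R) a : asummable a -> asummable (fun i => k * a i).
Proof.
move=> sa; rewrite /summable (_ : \esum_(_ in D) _ =
    \esum_(i in D) (`|k| * `|a i|)%:E)%E.
  by rewrite esum_normZ// lte_mul_pinfty// lee_fin.
by apply: eq_esum => i _; rewrite /= normrM.
Qed.

Lemma fin_num_esum a : (forall i, D i -> 0 <= a i) -> asummable a ->
  (\esum_(i in D) (a i)%:E)%E \is a fin_num.
Proof.
move=> a0; rewrite summableE (@eq_esum _ _ _ _ (EFin \o a))// => i Di.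
by rewrite /= ger0_norm ?a0.
Qed.

(** The value of [rsum] on a difference of nonnegative summable families does
    not depend on the decomposition; linearity follows from this. *)
Lemma rsum_sub p q : (forall i, D i -> 0 <= p i) -> (forall i, D i -> 0 <= q i) ->
  asummable p -> asummable q ->
  rsum D (fun i => p i - q i) =
  fine (\esum_(i in D) (p i)%:E) - fine (\esum_(i in D) (q i)%:E).
Proof.
move=> p0 q0 sp sq; rewrite /rsum.
have sB : asummable (fun i => p i - q i).
  by apply: asummableD => //; exact: asummableN.
rewrite -fineB; first rewrite -fineB; try exact: fin_num_esum.
- congr fine; have := esumB sp sq p0 q0 => /= <-; congr (_ - _)%E.
    by apply: eq_esum => i _; rewrite funeposE EFin_max.
  by apply: eq_esum => i _; rewrite funenegE EFin_max.
- apply: fin_num_esum => [i _|]; first by rewrite le_max lexx orbT.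
  apply: le_summable sB => i _.
  rewrite ger0_norm ?le_max ?lexx ?orbT//.
  by rewrite ge_max normr_ge0 andbT ler_norm.
- apply: fin_num_esum => [i _|]; first by rewrite le_max lexx orbT.
  apply: le_summable sB => i _.
  rewrite ger0_norm ?le_max ?lexx ?orbT//.
  by rewrite ge_max normr_ge0 andbT -normrN ler_norm.
Qed.

Lemma eq_rsum a b : (forall i, D i -> a i = b i) -> rsum D a = rsum D b.
Proof.
by move=> ab; rewrite /rsum; congr (fine _ - fine _); apply: eq_esum => i Di;
  rewrite ab.
Qed.

Lemma rsum_ge0E a : (forall i, D i -> 0 <= a i) -> asummable a ->
  rsum D a = fine (\esum_(i in D) (a i)%:E).
Proof.
move=> a0 sa; rewrite (@eq_rsum _ (fun i => a i - 0)); last first.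
  by move=> i _; rewrite subr0.
rewrite rsum_sub//.
  by rewrite [X in _ - fine X]esum1// subr0.
by rewrite /summable esum1// => i _; rewrite /= normr0.
Qed.

Let pos a i := Num.max (a i) 0.
Let neg a i := Num.max (- a i) 0.

Let posneg a i : a i = pos a i - neg a i.
Proof. by rewrite /pos /neg; case: leP => ?; case: leP => ?; lra. Qed.

Let pos_ge0 a i : D i -> 0 <= pos a i.
Proof. by rewrite /pos le_max lexx orbT. Qed.

Let neg_ge0 a i : D i -> 0 <= neg a i.
Proof. by rewrite /neg le_max lexx orbT. Qed.

Let pos_sum a : asummable a -> asummable (pos a).
Proof.
apply: le_summable => i _; rewrite ger0_norm /pos ?le_max ?lexx ?orbT//.
by rewrite ge_max normr_ge0 andbT ler_norm.
Qed.

Let neg_sum a : asummable a -> asummable (neg a).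
Proof.
apply: le_summable => i _; rewrite ger0_norm /neg ?le_max ?lexx ?orbT//.
by rewrite ge_max normr_ge0 andbT -normrN ler_norm.
Qed.

Lemma rsumD a b : asummable a -> asummable b ->
  rsum D (fun i => a i + b i) = rsum D a + rsum D b.
Proof.
move=> sa sb.
have pa := pos_sum sa; have pb := pos_sum sb.
have na := neg_sum sa; have nb := neg_sum sb.
rewrite (@eq_rsum _ (fun i => (pos a i + pos b i) - (neg a i + neg b i))).
  rewrite rsum_sub; try exact: asummableD; last 2 first.
  - by move=> i Di; rewrite addr_ge0 ?pos_ge0.
  - by move=> i Di; rewrite addr_ge0 ?neg_ge0.
  rewrite /rsum; under eq_esum do rewrite EFinD.
  rewrite esumD; try by move=> i Di; rewrite lee_fin pos_ge0.
  under [X in _ - fine X]eq_esum do rewrite EFinD.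
  rewrite esumD; try by move=> i Di; rewrite lee_fin neg_ge0.
  rewrite !fineD; try by apply: fin_num_esum => // i Di;
    rewrite ?pos_ge0 ?neg_ge0.
  rewrite /pos /neg; ring.
by move=> i _; rewrite (posneg a) (posneg b); ring.
Qed.

Lemma rsumN a : asummable a -> rsum D (fun i => - a i) = - rsum D a.
Proof.
move=> sa; rewrite /rsum opprB; congr (fine _ - fine _).
by apply: eq_esum => i _; rewrite opprK.
Qed.

Lemma rsumB a b : asummable a -> asummable b ->
  rsum D (fun i => a i - b i) = rsum D a - rsum D b.
Proof. by move=> sa sb; rewrite rsumD ?rsumN//; exact: asummableN. Qed.

Lemma rsumZ (k : R) a : asummable a -> rsum D (fun i => k * a i) = k * rsum D a.
Proof.
wlog k0 : k / 0 <= k => [hw|] sa.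
  have [k0|/ltW k0] := leP 0 k; first exact: hw.
  rewrite -[k in RHS]opprK mulNr -hw ?oppr_ge0// -rsumN; last exact: asummableZ.
  by apply: eq_rsum => i _; rewrite mulNr opprK.
have esumZ (p : T -> R) : (forall i, D i -> 0 <= p i) ->
    (\esum_(i in D) (k * p i)%:E = k%:E * \esum_(i in D) (p i)%:E)%E.
  move=> p0.
  rewrite (@eq_esum _ _ _ _ (fun i => (k * `|p i|)%:E)); last first.
    by move=> i Di; rewrite ger0_norm ?p0.
  rewrite esum_normZ//; congr (_ * _)%E.
  by apply: eq_esum => i Di; rewrite ger0_norm ?p0.
rewrite (@eq_rsum _ (fun i => k * pos a i - k * neg a i)).
  rewrite rsum_sub; last 4 first.
  - by move=> i Di; rewrite mulr_ge0 ?pos_ge0.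
  - by move=> i Di; rewrite mulr_ge0 ?neg_ge0.
  - exact/asummableZ/pos_sum.
  - exact/asummableZ/neg_sum.
  rewrite !esumZ; [|exact: neg_ge0|exact: pos_ge0].
  rewrite !fineM//; try by apply: fin_num_esum; first [exact: neg_ge0
    |exact: pos_ge0|exact: pos_sum|exact: neg_sum].
  by rewrite /rsum /pos /neg mulrBr.
by move=> i _; rewrite (posneg a) mulrBr.
Qed.

Lemma rsum_ge0 a : (forall i, D i -> 0 <= a i) -> 0 <= rsum D a.
Proof.
move=> a0; rewrite /rsum [X in _ - fine X]esum1 ?subr0; last first.
  by move=> i Di; rewrite max_r// oppr_le0 a0.
by apply/fine_ge0/esum_ge0 => i _; rewrite lee_fin le_max lexx orbT.
Qed.

End rsum_theory.

(** * The Dirichlet form on real functions *)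

(** The discriminant inequality; the case [a = 0] yields [b = 0]. *)
Lemma quad_discr (R : realFieldType) (a b d : R) : 0 <= d ->
  (forall t, 0 <= a + 2 * t * b + t ^+ 2 * d) -> b ^+ 2 <= a * d.
Proof.
rewrite le_eqVlt => /predU1P[<-|d0] H.
  have [->|b0] := eqVneq b 0; first by rewrite mulr0 expr0n.
  (* With no quadratic term, this [t] makes the affine function equal to -1. *)
  have := H (- (a + 1) / (2 * b)).
  rewrite (_ : a + _ + _ = -1); first lra.
  by field.
have := H (- b / d).
rewrite (_ : a + _ + _ = (a * d - b ^+ 2) / d).
  by rewrite pmulr_lge0 ?invr_gt0// subr_ge0.
by field; rewrite gt_eqF.
Qed.

Section real_energy.
Variables (R : realType) (V : countType) (E : rel V) (c : V -> V -> R) (o : V).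
Hypothesis hG : network E c o.
Implicit Types u w : V -> R.

Local Notation D := (edges E).
Local Notation asummable a := (summable D (EFin \o a)).

(** The contribution of an oriented edge to the polarized energy. *)
Definition edge_form u w (e : V * V) : R :=
  c e.1 e.2 * (u e.1 - u e.2) * (w e.1 - w e.2).

(** The real functions of finite energy that vanish at the base point. *)
Definition real_energy_space : set (V -> R) :=
  [set u | u o = 0 /\ asummable (edge_form u u)].

Local Notation H := real_energy_space.

(** The real energy inner product (Dirichlet form). The sum runs over oriented
    edges, so that each edge is counted twice, whence the factor 1/2. *)
Definition edot u w : R := 2^-1 * rsum D (edge_form u w).

Let cgt0 e : D e -> 0 < c e.1 e.2.
Proof. exact: (network_cond_gt0 hG). Qed.

Lemma edge_form_ge0 u e : D e -> 0 <= edge_form u u e.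
Proof.
by move=> De; rewrite /edge_form -mulrA -expr2 mulr_ge0 ?sqr_ge0 ?ltW ?cgt0.
Qed.

Lemma summable_edot u w : H u -> H w -> asummable (edge_form u w).
Proof.
move=> [_ su] [_ sw]; apply: le_summable (asummableD su sw) => e De.
rewrite /= [leRHS]ger0_norm; last by rewrite addr_ge0// edge_form_ge0.
rewrite ler_norml /edge_form; have /ltW := cgt0 De.
set k := c _ _; set a := u _ - _; set b := w _ - _ => k0.
have := mulr_ge0 k0 (sqr_ge0 a); have := mulr_ge0 k0 (sqr_ge0 b).
have := mulr_ge0 k0 (sqr_ge0 (a + b)); have := mulr_ge0 k0 (sqr_ge0 (a - b)).
by move=> *; apply/andP; split; lra.
Qed.

(** A function whose increments are dominated by those of two functions of finite
    energy has finite energy. Closure under linear combinations, lattice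
    operations and bounded products are instances. *)
Lemma dominated_finite_energy (K : R) u w1 w2 :
  u o = 0 -> H w1 -> H w2 ->
  (forall x y, `|u x - u y| <= K * (`|w1 x - w1 y| + `|w2 x - w2 y|)) -> H u.
Proof.
move=> uo [_ s1] [_ s2] le; split=> //.
apply: le_summable (asummableZ (2 * K ^+ 2) (asummableD s1 s2)) => e De.
have c0 := cgt0 De.
rewrite /= ger0_norm ?edge_form_ge0// ger0_norm; last first.
  by rewrite mulr_ge0 ?addr_ge0 ?edge_form_ge0// mulr_ge0 ?sqr_ge0.
have {}le : (u e.1 - u e.2) ^+ 2 <=
   2 * K ^+ 2 * ((w1 e.1 - w1 e.2) ^+ 2 + (w2 e.1 - w2 e.2) ^+ 2).
  rewrite -[leLHS]real_normK ?num_real//.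
  rewrite -[_ ^+ 2 in X in _ * (X + _)]real_normK ?num_real//.
  rewrite -[_ ^+ 2 in X in _ * (_ + X)]real_normK ?num_real//.
  have := le e.1 e.2; have := normr_ge0 (u e.1 - u e.2).
  set x := `|_|; set y := `|_|; set z := `|_|.
  move=> x0 xyz; apply: (@le_trans _ _ ((K * (y + z)) ^+ 2)).
    by rewrite lerXn2r// nnegrE (le_trans x0 xyz).
  have := mulr_ge0 (sqr_ge0 K) (sqr_ge0 (y - z)); nra.
rewrite /edge_form -!mulrA -!expr2; nra.
Qed.

Lemma real_energy_space0 : H (fun=> 0).
Proof.
split=> //; rewrite /summable esum1// => e _ /=.
by rewrite /edge_form subrr mulr0 normr0.
Qed.

Lemma real_energy_spaceZ k u : H u -> H (fun x => k * u x).
Proof.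
move=> Hu; apply: (dominated_finite_energy (K := `|k|) _ Hu Hu).
  by case: Hu => ->; rewrite mulr0.
move=> x y; rewrite -mulrBr normrM ler_wpM2l// lerDl//.
Qed.

Lemma real_energy_spaceD u w : H u -> H w -> H (fun x => u x + w x).
Proof.
move=> Hu Hw; apply: (dominated_finite_energy (K := 1) _ Hu Hw).
  by case: Hu => ->; case: Hw => ->; rewrite addr0.
by move=> x y; rewrite mul1r opprD addrACA ler_normD.
Qed.

Lemma real_energy_spaceB u w : H u -> H w -> H (fun x => u x - w x).
Proof.
move=> Hu Hw; have := real_energy_spaceD Hu (real_energy_spaceZ (-1) Hw).
by congr (H _); apply/funext => x; rewrite mulN1r.
Qed.

Lemma edotC u w : edot u w = edot w u.
Proof. by congr (_ * _); apply: eq_rsum => e _; rewrite /edge_form mulrAC. Qed.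

Lemma edotDl u w f : H u -> H w -> H f ->
  edot (fun x => u x + w x) f = edot u f + edot w f.
Proof.
move=> Hu Hw Hf; rewrite /edot -mulrDr -rsumD; [|exact: summable_edot..].
by congr (_ * _); apply: eq_rsum => e _; rewrite /edge_form; ring.
Qed.

Lemma edotZl k u f : H u -> H f -> edot (fun x => k * u x) f = k * edot u f.
Proof.
move=> Hu Hf; rewrite /edot mulrCA -(rsumZ k); last exact: summable_edot.
by congr (_ * _); apply: eq_rsum => e _; rewrite /edge_form; ring.
Qed.

Lemma edotZZ k u : H u ->
  edot (fun x => k * u x) (fun x => k * u x) = k ^+ 2 * edot u u.
Proof.
move=> Hu; have Hku := real_energy_spaceZ k Hu.
by rewrite edotZl// edotC edotZl// mulrA expr2.
Qed.

Lemma edotBl u w f : H u -> H w -> H f ->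
  edot (fun x => u x - w x) f = edot u f - edot w f.
Proof.
move=> Hu Hw Hf; rewrite (_ : (fun x => u x - w x) = (fun x => u x + -1 * w x)).
  by rewrite edotDl ?edotZl ?mulN1r//; exact: real_energy_spaceZ.
by apply/funext => x; rewrite mulN1r.
Qed.

Lemma edot_ge0 u : 0 <= edot u u.
Proof. by rewrite mulr_ge0 ?invr_ge0// rsum_ge0// => e; exact: edge_form_ge0. Qed.

Lemma edot_quad u w t : H u -> H w ->
  edot (fun x => u x + t * w x) (fun x => u x + t * w x) =
  edot u u + 2 * t * edot u w + t ^+ 2 * edot w w.
Proof.
move=> Hu Hw; have Ht := real_energy_spaceZ t Hw.
have Hs := real_energy_spaceD Hu Ht.
have edotr f : H f -> edot (fun x => u x + t * w x) f = edot u f + t * edot w f.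
  by move=> Hf; rewrite edotDl// edotZl.
rewrite edotr// [edot u _]edotC [edot w (fun _ => _)]edotC !edotr// [edot w u]edotC.
ring.
Qed.

Lemma edot_cauchy_schwarz u w : H u -> H w ->
  edot u w ^+ 2 <= edot u u * edot w w.
Proof.
move=> Hu Hw; apply: quad_discr => [|t]; first exact: edot_ge0.
by rewrite -edot_quad// edot_ge0.
Qed.

Lemma edot_parallelogram u w : H u -> H w ->
  edot (fun x => u x - w x) (fun x => u x - w x) =
  2 * edot u u + 2 * edot w w - edot (fun x => u x + w x) (fun x => u x + w x).
Proof.
move=> Hu Hw.
rewrite (_ : (fun x => u x - w x) = (fun x => u x + (-1) * w x)); last first.
  by apply/funext => x; rewrite mulN1r.
rewrite (_ : (fun x => u x + w x) = (fun x => u x + 1 * w x)); last first.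
  by apply/funext => x; rewrite mul1r.
rewrite !edot_quad//; ring.
Qed.

Lemma edotE u : H u -> edot u u = 2^-1 * fine (\esum_(e in D) (edge_form u u e)%:E).
Proof.
by move=> [_ su]; rewrite /edot rsum_ge0E// => e; exact: edge_form_ge0.
Qed.

Lemma esum_edot u : H u ->
  (\esum_(e in D) (edge_form u u e)%:E = (2 * edot u u)%:E)%E.
Proof.
move=> Hu; rewrite edotE// mulVKf ?pnatr_eq0// fineK// fin_num_esum//.
  by move=> e; exact: edge_form_ge0.
by case: Hu.
Qed.

(** The energy dominates the term of a single edge. *)
Lemma edge_bound a b u : E a b -> H u ->
  `|u b - u a| <= Num.sqrt (2 / c a b) * Num.sqrt (edot u u).
Proof.
move=> Eab Hu; have c0 : 0 < c a b := @cgt0 (a, b) Eab.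
rewrite -sqrtrM; last by rewrite divr_ge0 ?ltW.
rewrite -(@ler_pXn2r _ 2)// ?nnegrE ?sqrtr_ge0//.
rewrite sqr_sqrtr; last by rewrite mulr_ge0 ?divr_ge0 ?edot_ge0 // ltW.
rewrite real_normK ?num_real// mulrAC ler_pdivlMr//.
rewrite -lee_fin -esum_edot//; apply: esum_ge; exists [set (a, b)].
  by split=> // _ ->.
rewrite fsbig_set1 lee_fin /edge_form/=; nra.
Qed.

Lemma path_bound p a : path E a p -> exists2 K : R, 0 <= K &
  forall u, H u -> `|u (last a p) - u a| <= K * Num.sqrt (edot u u).
Proof.
elim: p a => [a _|b p IH a /= /andP[Eab /IH[K K0 HK]]].
  by exists 0 => // u _; rewrite subrr normr0 mul0r.
exists (K + Num.sqrt (2 / c a b)); first by rewrite addr_ge0 ?sqrtr_ge0.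
move=> u Hu; rewrite (le_trans (ler_distD (u b) _ _))// mulrDl.
by rewrite lerD ?HK ?edge_bound.
Qed.

(** Evaluation at a vertex is bounded for the energy norm, since the network is
    connected. *)
Lemma point_bound x : exists2 K : R, 0 <= K &
  forall u, H u -> `|u x| <= K * Num.sqrt (edot u u).
Proof.
have [->|/(network_connected hG)[p [Ep <-]]] := eqVneq x o.
  by exists 0 => // u [-> _]; rewrite normr0 mul0r.
have [K K0 HK] := path_bound Ep; exists K => // u Hu.
by have := HK _ Hu; case: Hu => -> _; rewrite subr0.
Qed.

(** By local finiteness only finitely many edges contribute. *)
Lemma indicator_energy x : x != o -> H (fun y => (y == x)%:R).
Proof.
move=> xo; split; first by rewrite eq_sym (negbTE xo).
have fx := network_locally_finite hG x.
set F := (pair x @` [set y | E x y]) `|` ((fun y => (y, x)) @` [set y | E x y]).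
have finF : finite_set F.
  by rewrite finite_setU; split; apply: finite_image.
rewrite /summable.
rewrite (@esumID _ _ F D)//.
rewrite [X in (_ + X)%E]esum1 ?adde0; last first.
  move=> [a b] [Eab nF].
  have ax : (a == x) = false.
    apply/negP => /eqP ax; apply: nF; left; exists b; last by rewrite ax.
    by rewrite -ax; exact: Eab.
  have bx : (b == x) = false.
    apply/negP => /eqP bx; apply: nF; right; exists a; last by rewrite bx.
    by rewrite -bx; exact: (network_sym hG).
  by rewrite /= /edge_form /= ax bx subrr mulr0 normr0.
have finDF : finite_set (D `&` F) by exact: finite_setIr.
rewrite esum_fset//; under eq_fsbigr do rewrite abse_EFin.
by rewrite fsumEFin// ltry.
Qed.

End real_energy.

(** * Existence of real dipoles by energy minimization *)

Section real_dipole.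
Variables (R : realType) (V : countType) (E : rel V) (c : V -> V -> R) (o : V).
Hypothesis hG : network E c o.
Implicit Types u w f : V -> R.

Local Notation D := (edges E).
Local Notation H := (real_energy_space E c o).
Local Notation edot := (edot E c).
Local Notation edge_form := (edge_form c).

(** Lower semicontinuity of the energy under pointwise convergence. *)
Lemma energy_lsc (s : nat -> V -> R) (r : nat -> R) u (m : R) :
  (forall n, H (s n)) -> (forall n, edot (s n) (s n) <= r n) ->
  (forall y, s n y @[n --> \oo] --> u y) -> r n @[n --> \oo] --> m ->
  H u /\ edot u u <= m.
Proof.
move=> Hs sr su rm.
have le : (\esum_(e in D) (edge_form u u e)%:E <= (2 * m)%:E)%E.
  apply: ge_ereal_sup => _ [X [finX XD] <-].
  rewrite fsumEFin// lee_fin fsbig_finite//=.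
  have cvg_sum :
    (fun n => \sum_(e <- finmap.enum_fset (fset_set X)) edge_form (s n) (s n) e)
      @ \oo
      --> \sum_(e <- finmap.enum_fset (fset_set X)) edge_form u u e.
    apply: cvg_big; first exact: add_continuous.
    move=> e _; rewrite /edge_form.
    by apply: cvgM; [apply: cvgMr|]; apply: cvgB; exact: su.
  have cvg_r : 2 * r n @[n --> \oo] --> 2 * m by exact: cvgMr.
  apply: (ler_cvg_to cvg_sum cvg_r).
  apply: nearW => n; apply: (@le_trans _ _ (2 * edot (s n) (s n))); last first.
    by rewrite ler_pM2l.
  rewrite -lee_fin -(esum_edot hG)//; apply: esum_ge; exists X => //.
  by rewrite fsumEFin// fsbig_finite.
have Hu : H u.
  split.
    have := su o; rewrite (_ : (fun n => s n o) = fun=> 0); last first.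
      by apply/funext => n; case: (Hs n).
    by move=> s0; apply: (cvg_unique _ s0); [exact: Rhausdorff | exact: cvg_cst].
  apply: le_lt_trans (ltry (2 * m)); apply: le_trans le.
  by apply: le_esum => e De /=; rewrite lee_fin ger0_norm ?(edge_form_ge0 hG).
by split=> //; move: le; rewrite (esum_edot hG)// lee_fin ler_pM2l.
Qed.

Lemma energy_minimizer x : x != o -> exists u,
  [/\ H u, u x = 1 & forall w, H w -> w x = 1 -> edot u u <= edot w w].
Proof.
move=> xo; pose A := [set edot u u | u in [set u | H u /\ u x = 1]].
pose m := inf A.
have lbA : has_lbound A by exists 0 => _ [u _ <-]; exact: (edot_ge0 hG).
have m_le w : H w -> w x = 1 -> m <= edot w w.
  by move=> Hw wx; apply: ge_inf => //; exists w.
have infA : has_inf A.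
  split=> //; exists (edot (fun y => (y == x)%:R) (fun y => (y == x)%:R)).
  exists (fun y => (y == x)%:R) => //; split; last by rewrite eqxx.
  exact: (indicator_energy hG).
have /choice[s hs] : forall n, exists u,
    [/\ H u, u x = 1 & edot u u <= m + n.+1%:R^-1].
  move=> n; have [_ [u [Hu ux] <-] um] := @inf_adherent _ A n.+1%:R^-1
    (ltac:(by rewrite invr_gt0)) infA.
  by exists u; split => //; exact: ltW.
have Hs n : H (s n) by case: (hs n).
have s1 n : s n x = 1 by case: (hs n).
have sm n : edot (s n) (s n) <= m + n.+1%:R^-1 by case: (hs n).
(* The half sum of two competitors is a competitor, so the parallelogram law
   makes a minimizing sequence Cauchy for the energy. *)
have diff n k : edot (fun y => s n y - s k y) (fun y => s n y - s k y) <=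
    2 * n.+1%:R^-1 + 2 * k.+1%:R^-1.
  rewrite (edot_parallelogram hG)//.
  have Hsum := real_energy_spaceD hG (Hs n) (Hs k).
  have Hmid := real_energy_spaceZ hG 2^-1 Hsum.
  have := m_le _ Hmid; rewrite s1 s1 mulrC mulfV ?pnatr_eq0// => /(_ erefl).
  rewrite (edotZZ hG)//.
  have aux (l a b d p q : R) : a <= l + p -> b <= l + q ->
      l <= 2^-1 ^+ 2 * d -> 2 * a + 2 * b - d <= 2 * p + 2 * q by lra.
  exact: aux.
have /choice[u su] : forall y, exists l, s n y @[n --> \oo] --> (l : R).
  move=> y; have [K K0 HK] := point_bound hG y.
  suff : cvg (s n y @[n --> \oo]) by move=> ?; exists (lim (s n y @[n --> \oo])).
  apply: cauchy_cvg; apply: cauchy_exP => e e0.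
  have [N _ HN] : \forall n \near \oo, K * Num.sqrt (4 * n.+1%:R^-1) < e.
    have : K * Num.sqrt (4 * n.+1%:R^-1) @[n --> \oo] --> K * Num.sqrt (4 * 0).
      apply: cvgMr; apply: continuous_cvg; first exact: sqrt_continuous.
      by apply: cvgMr; exact: cvg_harmonic.
    rewrite mulr0 sqrtr0 mulr0 => /cvgr0_norm_lt/(_ e e0).
    by apply: filterS => n; rewrite ger0_norm// mulr_ge0 ?sqrtr_ge0.
  exists (s N y); exists N => // n /= Nn.
  have := HN N (leqnn N); rewrite /ball/=; apply: le_lt_trans.
  apply: le_trans (HK _ (real_energy_spaceB hG (Hs N) (Hs n))) _.
  rewrite ler_wpM2l// ler_wsqrtr//; apply: le_trans (diff _ _) _.
  have : n.+1%:R^-1 <= N.+1%:R^-1 :> R by rewrite lef_pV2 ?posrE// ler_nat.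
  by move: n.+1%:R^-1 N.+1%:R^-1 => p q pq; lra.
have [Hu um] : H u /\ edot u u <= m.
  apply: (energy_lsc Hs sm su); rewrite -[X in _ --> X]addr0.
  by apply: cvgD; [exact: cvg_cst | exact: cvg_harmonic].
exists u; split=> //; last by move=> w Hw wx; exact: (le_trans um (m_le _ _ _)).
have := su x; rewrite (_ : (fun n => s n x) = fun=> 1); last first.
  by apply/funext => n.
by move=> s0; apply: (cvg_unique _ s0); [exact: Rhausdorff | exact: cvg_cst].
Qed.

(** The first variation at the minimizer [u] shows that [u] is orthogonal to the
    functions vanishing at [x], so that a multiple of [u] is the dipole. *)
Lemma real_dipole_exists x : exists2 v, H v & forall f, H f -> edot v f = f x.
Proof.
have [->|xo] := eqVneq x o.
  have H0 := real_energy_space0 E c o; exists (fun=> 0) => // f Hf.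
  have := edotZl hG 0 H0 Hf; rewrite !mul0r => ->.
  by case: Hf.
have [u [Hu ux umin]] := energy_minimizer xo.
have orth f : H f -> f x = 0 -> edot u f = 0.
  move=> Hf fx; apply/eqP; rewrite -sqrf_eq0 eq_le sqr_ge0 andbT.
  rewrite -[leRHS](mul0r (edot f f)); apply: quad_discr => [|t].
    exact: (edot_ge0 hG).
  have Htf := real_energy_spaceZ hG t Hf.
  have := umin _ (real_energy_spaceD hG Hu Htf).
  rewrite fx mulr0 addr0 (edot_quad hG)// => /(_ ux); lra.
(* [f - f x * u] vanishes at [x]. *)
have edotu f : H f -> edot u f = f x * edot u u.
  move=> Hf; have Hfu := real_energy_spaceZ hG (f x) Hu.
  have := orth _ (real_energy_spaceB hG Hf Hfu).
  rewrite ux mulr1 subrr => /(_ erefl).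
  rewrite edotC (edotBl hG)// (edotZl hG)// [edot f u]edotC.
  by move/eqP; rewrite subr_eq0 => /eqP.
have uu0 : edot u u != 0.
  have [K K0 HK] := point_bound hG x; apply/eqP => uu.
  by have := HK _ Hu; rewrite ux uu sqrtr0 mulr0 normr1 ler10.
exists (fun y => (edot u u)^-1 * u y); first exact: (real_energy_spaceZ hG).
by move=> f Hf; rewrite (edotZl hG)// (edotu f)// mulrCA mulVf// mulr1.
Qed.

End real_dipole.

(** * Complex energy space and resistance *)

Section complex_energy.
Variables (R : realType) (V : countType) (E : rel V) (c : V -> V -> R) (o : V).
Hypothesis hG : network E c o.

Local Notation D := (edges E).
Local Notation H := (real_energy_space E c o).
Local Notation HC := (energy_space E c o).
Local Notation edot := (edot E c).
Local Notation edge_form := (edge_form c).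
Local Notation Re := (@complex.Re R).
Local Notation Im := (@complex.Im R).
Implicit Types (f g h : V -> R[i]) (u w : V -> R).

Lemma complex_ReB (z z' : R[i]) : Re (z - z') = Re z - Re z'.
Proof. by case: z; case: z'. Qed.

Lemma complex_ImB (z z' : R[i]) : Im (z - z') = Im z - Im z'.
Proof. by case: z; case: z'. Qed.

Lemma normc_sqr (z : R[i]) : Normc.normc z ^+ 2 = Re z ^+ 2 + Im z ^+ 2.
Proof. by case: z => a b /=; rewrite sqr_sqrtr// addr_ge0 ?sqr_ge0. Qed.

Lemma energyE f : energy E c f =
  (2^-1%:E * (\esum_(e in D) (edge_form (Re \o f) (Re \o f) e)%:E +
              \esum_(e in D) (edge_form (Im \o f) (Im \o f) e)%:E))%E.
Proof.
rewrite /energy -esumD; try by move=> e De; rewrite lee_fin (edge_form_ge0 hG).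
congr (_ * _)%E; apply: eq_esum => e _; rewrite -EFinD; congr EFin.
by rewrite normc_sqr complex_ReB complex_ImB /edge_form/=; ring.
Qed.

Lemma summable_edge_form u : summable D (EFin \o edge_form u u) <->
  (\esum_(e in D) (edge_form u u e)%:E < +oo)%E.
Proof.
rewrite /summable (@eq_esum _ _ _ _ (fun e => (edge_form u u e)%:E))//.
by move=> e De; rewrite /= ger0_norm ?(edge_form_ge0 hG).
Qed.

(** A complex function has finite energy if and only if its real and imaginary
    parts do. *)
Lemma energy_spaceP f : HC f <-> H (Re \o f) /\ H (Im \o f).
Proof.
have ge0 u : (0 <= \esum_(e in D) (edge_form u u e)%:E)%E.
  by apply: esum_ge0 => e De; rewrite lee_fin (edge_form_ge0 hG).
split=> [[fo]|[[ro /summable_edge_form rfin] [io /summable_edge_form ifin]]].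
  rewrite energyE => fin.
  have {}fin : (\esum_(e in D) (edge_form (Re \o f) (Re \o f) e)%:E +
              \esum_(e in D) (edge_form (Im \o f) (Im \o f) e)%:E < +oo)%E.
    rewrite ltNge leye_eq; apply/negP => /eqP ey; move: fin; rewrite ey.
    by rewrite gt0_muley ?lte_fin ?invr_gt0.
  split; (split; first by rewrite /= fo); apply/summable_edge_form;
    apply: le_lt_trans fin; first exact: leeDl.
  exact: leeDr.
split; first by move: ro io; rewrite /=; case: (f o) => a b /= -> ->.
rewrite energyE; apply: lte_mul_pinfty; rewrite ?lee_fin ?invr_ge0//.
exact: lte_add_pinfty.
Qed.

Lemma fine_energy f : HC f ->
  fine (energy E c f) = edot (Re \o f) (Re \o f) + edot (Im \o f) (Im \o f).
Proof.
move=> /energy_spaceP[Hr Hi]; rewrite energyE !(esum_edot hG)//=.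
by rewrite -mulrDr mulKf.
Qed.

(** The complex inner product, which is conjugate linear on the left, in terms of
    the real one. *)
Lemma energy_innerE h f : HC h -> HC f -> energy_inner E c h f =
  Complex (edot (Re \o h) (Re \o f) + edot (Im \o h) (Im \o f))
          (edot (Re \o h) (Im \o f) - edot (Im \o h) (Re \o f)).
Proof.
move=> /energy_spaceP[hr hi] /energy_spaceP[fr fi].
have half : (2^-1 : R[i]) = (2^-1 : R)%:C%C by rewrite fmorphV rmorph_nat.
rewrite /energy_inner /csum half /edot.
have scale (k a b : R) : k%:C%C * Complex a b = Complex (k * a) (k * b).
  by apply/eqP; rewrite eq_complex /= !mul0r subr0 addr0 !eqxx.
rewrite scale -mulrDr -mulrBr -rsumD; [|exact: (summable_edot hG)..].
rewrite -rsumB; [|exact: (summable_edot hG)..].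
congr Complex; congr (_ * _); apply: eq_rsum => e _; rewrite /edge_form/=;
  case: (h e.1) => ? ?; case: (h e.2) => ? ?; case: (f e.1) => ? ?;
  case: (f e.2) => ? ? /=; ring.
Qed.

Lemma real_energy_spaceC u : H u -> HC (fun x => (u x)%:C%C).
Proof.
by move=> Hu; apply/energy_spaceP; split=> //; exact: real_energy_space0.
Qed.

Lemma dipoleP x : is_dipole E c o x (dipole E c o x).
Proof.
apply: xgetPex; have [v Hv vE] := real_dipole_exists hG x.
exists (fun y => (v y)%:C%C); split; first exact: real_energy_spaceC.
move=> f Hf; rewrite energy_innerE//; last exact: real_energy_spaceC.
have /energy_spaceP[fr fi] := Hf; have H0 := real_energy_space0 E c o.
have edot0 u : H u -> edot (fun=> 0) u = 0.
  by move=> Hu; have := edotZl hG 0 H0 Hu; rewrite !mul0r.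
rewrite [X in Complex (X + _)](vE _ fr) [X in Complex _ (X - _)](vE _ fi).
rewrite [X in Complex (_ + X)](edot0 _ fi) [X in Complex _ (_ - X)](edot0 _ fr).
case: Hf => -> _ /=; rewrite !subr0 addr0.
by case: (f x).
Qed.

(** The real parts of the dipoles reproduce the real functions of finite energy;
    the imaginary parts have zero energy and do not contribute to the
    resistance. *)
Lemma resistance_real_dipole : exists r : V -> V -> R,
  [/\ forall x, H (r x),
      forall x u, H u -> edot (r x) u = u x &
      forall x y, resistance E c o x y =
        edot (fun z => r x z - r y z) (fun z => r x z - r y z)].
Proof.
pose r x := Re \o dipole E c o x; pose s x := Im \o dipole E c o x.
have H0 := real_energy_space0 E c o.
have HD x : HC (dipole E c o x) by case: (dipoleP x).
have Hr x : H (r x) by have /energy_spaceP[] := HD x.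
have Hs x : H (s x) by have /energy_spaceP[] := HD x.
have edot0 u : H u -> edot u (fun=> 0) = 0.
  by move=> Hu; rewrite edotC; have := edotZl hG 0 H0 Hu; rewrite !mul0r.
have rs x u : H u -> edot (r x) u = u x /\ edot (s x) u = 0.
  move=> Hu; have HCu := real_energy_spaceC Hu.
  have [_ /(_ _ HCu)] := dipoleP x.
  rewrite energy_innerE//.
  have -> : Im \o (fun x => (u x)%:C%C) = fun=> 0 by [].
  have -> : Re \o (fun x => (u x)%:C%C) = u by [].
  rewrite (edot0 _ (Hr x)) (edot0 _ (Hs x)) addr0 sub0r => -[-> /eqP].
  rewrite subrr oppr_eq0 => /eqP ->.
  by case: Hu => -> _; rewrite subr0.
exists r; split => // [x u Hu|x y]; first by case: (rs x u Hu).
rewrite /resistance.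
have HCd : HC (fun z => dipole E c o x z - dipole E c o y z).
  apply/energy_spaceP; split.
    have := real_energy_spaceB hG (Hr x) (Hr y).
    by congr (H _); apply/funext => z /=; rewrite complex_ReB.
  have := real_energy_spaceB hG (Hs x) (Hs y).
  by congr (H _); apply/funext => z /=; rewrite complex_ImB.
rewrite fine_energy//.
have -> : Re \o (fun z => dipole E c o x z - dipole E c o y z) =
    fun z => r x z - r y z by apply/funext => z /=; rewrite complex_ReB.
have -> : Im \o (fun z => dipole E c o x z - dipole E c o y z) =
    fun z => s x z - s y z by apply/funext => z /=; rewrite complex_ImB.
have Hd := real_energy_spaceB hG (Hs x) (Hs y).
have s0 x' : edot (s x') (fun z => s x z - s y z) = 0 by case: (rs x' _ Hd).
by rewrite [X in _ + X](edotBl hG)// !s0 subrr addr0.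
Qed.

(** The reproducing property turned into a modulus of continuity. *)
Lemma energy_resistance u x y : H u ->
  (u x - u y) ^+ 2 <= edot u u * resistance E c o x y.
Proof.
move=> Hu; have [r [Hr rE ->]] := resistance_real_dipole.
have Hd := real_energy_spaceB hG (Hr x) (Hr y).
by rewrite -!rE// -(edotBl hG)// edotC (edot_cauchy_schwarz hG).
Qed.

(** Attained by the difference of the real dipoles at [x] and [y]. *)
Lemma resistance_peak x y : exists w,
  [/\ H w, edot w w = resistance E c o x y & w x - w y = resistance E c o x y].
Proof.
have [r [Hr rE res]] := resistance_real_dipole.
exists (fun z => r x z - r y z).
have Hd := real_energy_spaceB hG (Hr x) (Hr y).
by split=> //; rewrite res// [RHS](edotBl hG)// !rE.
Qed.

End complex_energy.

(** * Topology of the complex plane and extension from dense subsets *)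

Section complex_topology.
Variable R : realType.
Implicit Types z : R[i].

Lemma complex_normE z : `|z| = (normc z)%:C%C.
Proof. by []. Qed.

(** In the order of the complex numbers a positive number is real. *)
Lemma complex_gt0 (e : R[i]) : 0 < e -> exists2 e' : R, 0 < e' & e = e'%:C%C.
Proof.
rewrite ltcE /= => /andP[/eqP ie re]; exists (complex.Re e) => //.
by case: e ie {re} => a b /= ->.
Qed.

Lemma complex_ballE z (e : R) :
  ball (z : R[i]^o) e%:C%C = [set z' | normc (z - z') < e].
Proof. by apply/seteqP; split=> z'; rewrite /ball/= complex_normE ltcR. Qed.

Lemma complex_nbhsP z (A : set R[i]^o) : nbhs (z : R[i]^o) A <->
  exists2 e : R, 0 < e & [set z' | normc (z - z') < e] `<=` A.
Proof.
split.
  move=> /nbhs_ballP[e /= /complex_gt0[e' e0 ->]]; rewrite complex_ballE.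
  by exists e'.
move=> [e e0 eA]; apply/nbhs_ballP; exists e%:C%C; first by rewrite /= ltcR.
by rewrite complex_ballE.
Qed.

Lemma complex_entourageP (A : set (R[i]^o * R[i]^o)) : entourage A <->
  exists2 e : R, 0 < e & forall z z', normc (z - z') < e -> A (z, z').
Proof.
rewrite -entourage_ballE; split.
  move=> [e /= /complex_gt0[e' e0 ->] eA].
  by exists e' => // z z' zz'; apply: eA => /=; rewrite complex_ballE.
move=> [e e0 eA]; exists e%:C%C => /=; first by rewrite ltcR.
by move=> [z z'] /=; rewrite complex_ballE => /eA.
Qed.

Lemma normc_le_ReIm z : normc z <= `|complex.Re z| + `|complex.Im z|.
Proof.
rewrite -(@ler_pXn2r _ 2)// ?nnegrE ?addr_ge0 ?normc_ge0//; last first.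
  by case: z => a b /=; rewrite sqrtr_ge0.
rewrite normc_sqr sqrrD !real_normK ?num_real//.
by rewrite -addrA [_ *+ 2 + _]addrC addrA lerDl mulrn_wge0 ?mulr_ge0.
Qed.

Lemma Re_le_normc z : `|complex.Re z| <= normc z.
Proof.
case: z => a b /=; rewrite -sqrtr_sqr ler_wsqrtr// lerDl sqr_ge0//.
Qed.

Lemma Im_le_normc z : `|complex.Im z| <= normc z.
Proof.
case: z => a b /=; rewrite -sqrtr_sqr ler_wsqrtr// lerDr sqr_ge0//.
Qed.

Lemma complex_continuous (T : topologicalType) (a b : T -> R) :
  continuous a -> continuous b ->
  continuous (fun p => Complex (a p) (b p) : R[i]^o).
Proof.
move=> ca cb p A /complex_nbhsP[d d0 dA].
have d2 : 0 < d / 2 by rewrite divr_gt0.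
have /cvgrPdist_lt/(_ _ d2) nA := ca p; have /cvgrPdist_lt/(_ _ d2) nB := cb p.
have : \forall q \near p, `|a p - a q| < d / 2 /\ `|b p - b q| < d / 2.
  exact: filterI nA nB.
apply: filterS => q [aq bq]; apply: dA.
apply: le_lt_trans (normc_le_ReIm _) _; rewrite (splitr d).
exact: ltrD.
Qed.

End complex_topology.

Lemma sqrtr_subadd (R : rcfType) (a b : R) : 0 <= a -> 0 <= b ->
  Num.sqrt (a + b) <= Num.sqrt a + Num.sqrt b.
Proof.
move=> a0 b0; rewrite -(@ler_pXn2r _ 2)// ?nnegrE ?addr_ge0 ?sqrtr_ge0//.
rewrite sqrrD !sqr_sqrtr ?addr_ge0// -addrA [_ *+ 2 + _]addrC addrA lerDl.
by rewrite mulrn_wge0 ?mulr_ge0 ?sqrtr_ge0.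
Qed.

(** McShane's formula: a real function which is Hoelder continuous of exponent
    1/2 on a subset of a metric space extends with the same modulus. *)
Lemma holder_extension (R : realType) (X : Type) (M : metricType R)
    (iota : X -> M) (x0 : X) (u : X -> R) (C : R) : 0 <= C ->
  (forall x y, (u x - u y) ^+ 2 <= C * mdist (iota x) (iota y)) ->
  exists ut : M -> R, (forall x, ut (iota x) = u x) /\
    forall p q, `|ut p - ut q| <= Num.sqrt (C * mdist p q).
Proof.
move=> C0 uC; pose w (p q : M) := Num.sqrt (C * mdist p q).
have wC p q : w p q = w q p by rewrite /w metric_sym.
have w_tri p q r : w p r <= w p q + w q r.
  rewrite /w; apply: le_trans (sqrtr_subadd _ _); rewrite ?mulr_ge0 ?mdist_ge0//.
  by rewrite -mulrDr ler_wsqrtr// ler_wpM2l// metric_triangle.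
have uw x y : `|u x - u y| <= w (iota x) (iota y).
  by rewrite -sqrtr_sqr ler_wsqrtr.
pose A p := range (fun x => u x + w (iota x) p).
have A0 p : A p !=set0 by exists (u x0 + w (iota x0) p), x0.
have lbA p : has_lbound (A p).
  exists (u x0 - w (iota x0) p) => _ [x _ <-].
  have := uw x0 x; rewrite ler_norml => /andP[_].
  have := w_tri (iota x0) p (iota x); rewrite [w p _]wC; lra.
have infw p q : inf (A p) - w p q <= inf (A q).
  apply: lb_le_inf => // _ [x _ <-].
  have : inf (A p) <= u x + w (iota x) p by apply: ge_inf => //; exists x.
  have := w_tri (iota x) q p; rewrite [w q p]wC; lra.
exists (fun p => inf (A p)); split=> [x|p q].
  apply/eqP; rewrite eq_le; apply/andP; split.
    have : inf (A (iota x)) <= u x + w (iota x) (iota x).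
      by apply: ge_inf => //; exists x.
    by rewrite /w mdistxx mulr0 sqrtr0 addr0.
  apply: lb_le_inf => // _ [y _ <-].
  by have := uw x y; rewrite ler_norml [w _ _]wC => /andP[_]; lra.
rewrite -/(w p q) ler_norml; have := infw p q; have := infw q p; rewrite [w q p]wC.
by move=> ? ?; apply/andP; split; lra.
Qed.

Section extension.
Variables (R : realType) (X : Type) (M : metricType R) (iota : X -> M).
Hypothesis dense_iota : dense (range iota).

Lemma dense_nbhs (p : M) (U : set M) : nbhs p U -> exists x, U (iota x).
Proof.
move=> pU; have [||y [Uy [x _ xy]]] := dense_iota (O := U°).
- by exists p.
- exact: open_interior.
- by exists x; rewrite xy; exact: interior_subset Uy.
Qed.

Lemma continuous_extends_by_closure (f : X -> R[i]) (ft : M -> R[i]^o) :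
  continuous ft -> (forall x, ft (iota x) = f x) -> extends_by_closure iota f ft.
Proof.
move=> cft ftf; split=> //; apply/seteqP; split => [[p z] /= <-|[p z] /=].
  move=> B [[U W] /= [pU pW] UWB].
  have [x [Ux Wx]] := dense_nbhs (filterI pU (cft p _ pW)).
  exists (iota x, f x); split; first by exists x.
  by apply: UWB; split => //=; rewrite -ftf.
move=> clpz; apply/eqP; rewrite -subr_eq0; apply/eqP; apply: eq0_normc.
apply/eqP; rewrite eq_le; apply/andP; split; last first.
  by case: (_ - _) => a b; exact: sqrtr_ge0.
apply/ler_addgt0Pl => e e0; rewrite addr0.
pose W := [set z' : R[i]^o | normc (z - z') < e / 2].
have zW : nbhs (z : R[i]^o) W.
  by apply/complex_nbhsP; exists (e / 2); rewrite ?divr_gt0.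
pose W' := [set z' : R[i]^o | normc (ft p - z') < e / 2].
have pW' : nbhs (ft p : R[i]^o) W'.
  by apply/complex_nbhsP; exists (e / 2); rewrite ?divr_gt0.
have [_ [[x _ <-] [/= pU zx]]] := clpz (ft @^-1` W' `*` W)
  (ltac:(by exists (ft @^-1` W', W) => //; split => //; exact: cft)).
rewrite /W' /= ftf in pU.
rewrite -(subrK (f x) (ft p)) -addrA (splitr e).
apply: le_trans (le_normcD _ _) _; apply: lerD; first exact: ltW.
by rewrite -normcN opprB ltW.
Qed.

Lemma extends_by_closure_unique (f : X -> R[i]) (ft ft' : M -> R[i]^o) :
  extends_by_closure iota f ft -> extends_by_closure iota f ft' -> ft = ft'.
Proof.
move=> [_ g] [_ g']; apply/funext => p.
have : [set q : M * R[i]^o | ft q.1 = q.2] (p, ft' p) by rewrite g -g'.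
by [].
Qed.

(** The two sides are metric over different fields, real and complex, hence the
    formulation with real radii. *)
Lemma unif_continuous_modulus (ft : M -> R[i]^o) :
  (forall e, 0 < e -> exists2 d, 0 < d &
    forall p q, mdist p q < d -> normc (ft p - ft q) < e) ->
  unif_continuous ft.
Proof.
move=> H A /complex_entourageP[e e0 eA]; have [d d0 dH] := H e e0.
rewrite /= nbhs_simpl/= -entourage_ballE; exists d => // -[p q] /=.
by rewrite ballEmdist /= => /dH /eA.
Qed.

End extension.

(** * Lattice form of the Stone-Weierstrass theorem *)

Section kakutani_stone.
Variables (R : realType) (T : topologicalType).
Hypothesis cptT : compact [set: T].
Implicit Types (L : set (T -> R)) (u v g : T -> R).

(** A Dini-type argument: a family directed upwards which exceeds [g] at each
    point of a compact space has a member which exceeds [g] everywhere. *)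
Lemma compact_directed_gt L g : L !=set0 ->
  (forall u, L u -> continuous u) -> continuous g ->
  (forall u v, L u -> L v -> L (fun p => Num.max (u p) (v p))) ->
  (forall q, exists2 u, L u & g q < u q) ->
  exists2 u, L u & forall q, g q < u q.
Proof.
move=> L0 Lc gc Lmax Lg.
pose F := filter_from L (fun u => [set v | L v /\ forall q, u q <= v q]).
have FF : Filter F.
  apply: filter_from_filter; first exact: L0.
  move=> u v Lu Lv; exists (fun p => Num.max (u p) (v p)); first exact: Lmax.
  move=> w [Lw uvw]; split; split=> // q; apply: le_trans (uvw q).
    by rewrite le_max lexx.
  by rewrite le_max lexx orbT.
have /compact_near_coveringP cov := cptT.
have [|u Lu /(_ u)] := cov _ F (fun v q => g q < v q) FF.
  move=> q _; have [u Lu gu] := Lg q.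
  have nq : nbhs q [set p | g p < u p].
    have : \forall p \near q, 0 < u p - g p.
      have ug : u p - g p @[p --> q] --> u q - g q.
        by apply: cvgB; [exact: Lc | exact: gc].
      by apply: (cvgr_gt _ ug); rewrite subr_gt0.
    by apply: filterS => p; rewrite subr_gt0.
  exists ([set p | g p < u p], [set v | L v /\ forall q, u q <= v q]).
    by split => //; exists u.
  by move=> [p v] [/= gp [_ uv]]; exact: lt_le_trans gp (uv p).
by move=> Lu'; exists u => // q; apply: Lu'.
Qed.

(** The lattice form of the Stone-Weierstrass theorem. *)
Lemma kakutani_stone (p0 : T) L g (e : R) : 0 < e ->
  (forall u, L u -> continuous u) -> continuous g ->
  (forall u v, L u -> L v -> L (fun p => Num.max (u p) (v p))) ->
  (forall u, L u -> L (fun p => - u p)) ->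
  (forall p q, exists u, [/\ L u, u p = g p & u q = g q]) ->
  exists2 u, L u & forall p, `|u p - g p| < e.
Proof.
move=> e0 Lc gc Lmax LN Lint.
have above p : exists2 u, L u & u p < g p + e /\ forall q, g q - e < u q.
  pose Lp := [set u | L u /\ u p < g p + e].
  have Lpg q : exists2 u, Lp u & g q - e < u q.
    have [u [Lu up uq]] := Lint p q.
    by exists u; [split => //; rewrite up ltrDl | rewrite uq ltrBlDr ltrDl].
  have [|u [/Lc //]|q|u v [Lu up] [Lv vp]||u [Lu up] gu] :=
    @compact_directed_gt Lp (fun q => g q - e).
  - by have [u Lpu _] := Lpg p; exists u.
  - by apply: cvgB; [exact: gc | exact: cvg_cst].
  - by split; [exact: Lmax | rewrite /= gt_max up].
  - exact: Lpg.
  - by exists u.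
(* Among the members of [L] that exceed [g - e] everywhere, one is less than
   [g + e] everywhere: the opposites of these members are directed upwards. *)
pose L' := [set v | L (fun p => - v p) /\ forall q, g q - e < - v q].
have L'g p : exists2 v, L' v & - (g p + e) < v p.
  have [u Lu [up gu]] := above p; exists (fun p => - u p); last by rewrite ltrN2.
  split; last by move=> q; rewrite opprK.
  by rewrite (_ : (fun p => _) = u)//; apply/funext => q; rewrite opprK.
have [|v [Lv _]|q|u v [Lu gu] [Lv gv]||v [Lv gv] vg] :=
  @compact_directed_gt L' (fun p => - (g p + e)).
- by have [v L'v _] := L'g p0; exists v.
- rewrite (_ : v = fun p => - - v p); last by apply/funext => p; rewrite opprK.
  by move=> p; apply: cvgN; exact: (Lc _ Lv).
- by apply: cvgN; apply: cvgD; [exact: gc | exact: cvg_cst].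
- split => [|q].
    have := LN _ (Lmax _ _ (LN _ Lu) (LN _ Lv)).
    by congr (L _); apply/funext => p; rewrite !opprK.
  by rewrite oppr_max lt_min gu gv.
- exact: L'g.
exists (fun p => - v p) => // p.
by rewrite ltr_norml; have := vg p; have := gv p; move=> ? ?; apply/andP; split; lra.
Qed.

End kakutani_stone.

(** * Uniform continuity and uniform closure *)

(** Approximation in the uniform norm, with real radii. *)
Lemma closure_uniformP (R : realType) (M : topologicalType)
    (A : set (M -> R[i]^o)) (g : M -> R[i]^o) :
  closure (A : set {uniform M -> R[i]^o}) g <->
  forall e, 0 < e -> exists2 h, A h & forall p, normc (g p - h p) < e.
Proof.
split=> [clA e e0|H B /uniform_nbhs[U [/complex_entourageP[e e0 eU] UB]]].
  pose B := [set h : {uniform M -> R[i]^o} | forall p, normc (g p - h p) < e].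
  have [|h [Ah Bh]] := clA B; last by exists h.
  apply/uniform_nbhs; exists [set z : R[i]^o * R[i]^o | normc (z.1 - z.2) < e].
  split; first by apply/complex_entourageP; exists e.
  by move=> h gh p; exact: gh.
have [h Ah gh] := H e e0; exists h; split => //; apply: UB => p _.
exact: eU.
Qed.

Lemma unif_continuous_continuous (U V : uniformType) (f : U -> V) :
  unif_continuous f -> continuous f.
Proof.
move=> uf p A /nbhsP[B entB BA].
have /(_ _ entB) := uf; rewrite /= nbhs_simpl /= => entfB.
apply/nbhsP; exists [set xy | B (f xy.1, f xy.2)]; first exact: entfB.
by move=> q /xsectionP /= Bpq; apply: BA; apply/xsectionP.
Qed.

Lemma sqrtr_modulus (R : realType) (K e d : R) : 0 <= K -> 0 < e -> 0 <= d ->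
  d < e ^+ 2 / (K + 1) -> Num.sqrt (K * d) < e.
Proof.
move=> K0 e0 d0; rewrite ltr_pdivlMr ?ltr_wpDl// => dK.
rewrite -[ltRHS]ger0_norm ?ltW// -sqrtr_sqr ltr_sqrt ?exprn_gt0//.
by apply: le_lt_trans dK; rewrite mulrC ler_wpM2l// lerDl.
Qed.

Lemma holder_continuous (R : realType) (M : metricType R) (u : M -> R) (K : R) :
  0 <= K -> (forall p q, `|u p - u q| <= Num.sqrt (K * mdist p q)) ->
  continuous u.
Proof.
move=> K0 uK p; apply/cvgrPdist_lt => e e0.
have d0 : 0 < e ^+ 2 / (K + 1) by rewrite divr_gt0 ?exprn_gt0 ?ltr_wpDl.
apply: filterS (nbhsx_ballx p _ d0) => q; rewrite ballEmdist /= => pq.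
by apply: le_lt_trans (uK p q) _; rewrite sqrtr_modulus ?mdist_ge0.
Qed.

(** * Products and maxima of functions of finite energy *)

Section network_algebra.
Variables (R : realType) (V : countType) (E : rel V) (c : V -> V -> R) (o : V).
Hypothesis hG : network E c o.
Local Notation H := (real_energy_space E c o).
Local Notation HC := (energy_space E c o).
Implicit Types u w : V -> R.

Lemma real_energy_spaceM u w (K : R) : H u -> H w ->
  (forall x, `|u x| <= K) -> (forall x, `|w x| <= K) ->
  H (fun x => u x * w x).
Proof.
move=> Hu Hw uK wK; apply: (dominated_finite_energy hG (K := K) _ Hu Hw).
  by case: Hu => -> _; rewrite mul0r.
move=> x y.
rewrite (_ : _ - _ = (u x - u y) * w y + u x * (w x - w y)); last by ring.
apply: le_trans (ler_normD _ _) _; rewrite [leRHS]mulrDr !normrM.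
by apply: lerD; [rewrite mulrC|]; rewrite ler_wpM2r.
Qed.

Lemma real_energy_space_max u w : H u -> H w -> H (fun x => Num.max (u x) (w x)).
Proof.
move=> Hu Hw; apply: (dominated_finite_energy hG (K := 1) _ Hu Hw).
  by case: Hu => ->; case: Hw => ->; rewrite maxxx.
move=> x y; rewrite mul1r ler_norml; set b := `|_| + `|_|.
have : `|u x - u y| <= b by rewrite lerDl.
have : `|w x - w y| <= b by rewrite lerDr.
rewrite !ler_norml => /andP[? ?] /andP[? ?].
by apply/andP; split; case: (leP (u x)) => ?; case: (leP (u y)) => ?; lra.
Qed.

Lemma energy_space_algebra :
  (exists B : R, forall x y : V, resistance E c o x y <= B) ->
  pointwise_algebra HC.
Proof.
move=> [B resB].
have bounded u : H u -> exists K, forall x, `|u x| <= K.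
  move=> Hu; exists (Num.sqrt (edot E c u u * B)) => x.
  rewrite -sqrtr_sqr ler_wsqrtr//.
  have := energy_resistance hG x o Hu; case: (Hu) => -> _; rewrite subr0.
  move/le_trans; apply; rewrite ler_wpM2l ?resB//; exact: (edot_ge0 hG).
have HM u w : H u -> H w -> H (fun x => u x * w x).
  move=> Hu Hw; have [K uK] := bounded _ Hu; have [L wL] := bounded _ Hw.
  apply: (@real_energy_spaceM _ _ (Num.max K L)) => // x.
    by apply: le_trans (uK x) _; rewrite le_max lexx.
  by apply: le_trans (wL x) _; rewrite le_max lexx orbT.
have split_parts f u w : (forall x, f x = Complex (u x) (w x)) ->
    H u -> H w -> HC f.
  move=> fE Hu Hw; apply/(energy_spaceP hG); split.
    by move: Hu; congr (H _); apply/funext => x /=; rewrite fE.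
  by move: Hw; congr (H _); apply/funext => x /=; rewrite fE.
have HD := real_energy_spaceD hG; have HZ := real_energy_spaceZ hG.
have HB := real_energy_spaceB hG.
split.
- by apply: (split_parts _ _ _ (fun=> erefl)); exact: real_energy_space0.
- move=> f g /(energy_spaceP hG)[fr fi] /(energy_spaceP hG)[gr gi].
  apply: split_parts (HD _ _ fr gr) (HD _ _ fi gi) => x /=.
  by case: (f x) => ? ?; case: (g x) => ? ?.
- move=> [a b] f /(energy_spaceP hG)[fr fi].
  apply: split_parts (HB _ _ (HZ a _ fr) (HZ b _ fi))
    (HD _ _ (HZ a _ fi) (HZ b _ fr)) => x /=.
  by case: (f x).
- move=> f g /(energy_spaceP hG)[fr fi] /(energy_spaceP hG)[gr gi].
  apply: split_parts (HB _ _ (HM _ _ fr gr) (HM _ _ fi gi))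
    (HD _ _ (HM _ _ fr gi) (HM _ _ fi gr)) => x /=.
  by case: (f x) => ? ?; case: (g x) => ? ?.
Qed.

End network_algebra.

(** * Functions of finite energy on the completion *)

Section completion.
Variables (R : realType) (V : countType) (E : rel V) (c : V -> V -> R) (o : V).
Hypothesis hG : network E c o.
Local Notation H := (real_energy_space E c o).
Local Notation HC := (energy_space E c o).

Variables (M : metricType R) (iota : V -> M).
Hypothesis hM : is_completion (resistance E c o) iota.

Let dense_iota : dense (range iota).
Proof. by case: hM. Qed.

Let dist_iota x y : mdist (iota x) (iota y) = resistance E c o x y.
Proof. by case: hM. Qed.

Lemma real_energy_extension u : H u -> exists ut : M -> R,
  (forall x, ut (iota x) = u x) /\
  forall p q, `|ut p - ut q| <= Num.sqrt (edot E c u u * mdist p q).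
Proof.
move=> Hu; apply: (holder_extension o (edot_ge0 hG u)) => x y.
by rewrite dist_iota; exact: energy_resistance.
Qed.

Lemma energy_extension (f : V -> R[i]) : HC f -> exists ft : M -> R[i]^o,
  extends_by_closure iota f ft /\ unif_continuous ft.
Proof.
move=> /(energy_spaceP hG)[/real_energy_extension[a [af ac]]
  /real_energy_extension[b [bf bc]]].
pose ft p : R[i]^o := Complex (a p) (b p).
have uft : unif_continuous ft.
  set Ka := edot _ _ _ _ in ac; set Kb := edot _ _ _ _ in bc.
  have Ka0 : 0 <= Ka by exact: (edot_ge0 hG).
  have Kb0 : 0 <= Kb by exact: (edot_ge0 hG).
  apply: unif_continuous_modulus => e e0.
  have e2 : 0 < e / 2 by rewrite divr_gt0.
  exists (Num.min ((e / 2) ^+ 2 / (Ka + 1)) ((e / 2) ^+ 2 / (Kb + 1))).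
    by rewrite lt_min !divr_gt0 ?exprn_gt0 ?ltr_wpDl.
  move=> p q; rewrite lt_min => /andP[pa pb].
  apply: le_lt_trans (normc_le_ReIm _) _; rewrite /ft/= (splitr e).
  by apply: ltrD; [apply: le_lt_trans (ac p q) _ | apply: le_lt_trans (bc p q) _];
    rewrite sqrtr_modulus ?mdist_ge0.
exists ft; split => //; apply: continuous_extends_by_closure => //.
  exact: unif_continuous_continuous.
by move=> x; rewrite /ft af bf /=; case: (f x).
Qed.

(** The continuous real functions on the completion which restrict to functions
    of finite energy on the network. *)
Definition extended_energy_space : set (M -> R) :=
  [set u | continuous u /\ H (u \o iota)].

Local Notation L := extended_energy_space.

(** With [r] the resistance between vertices at distance less than [d / 8] from
    [p] and [q], where [d] is the distance from [p] to [q], the triangle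
    inequality gives [3 / 4 * d <= r]; the function [resistance_peak] increases
    by [r] between these vertices and oscillates by less than [r / 2] on the way
    to [p] and to [q]. *)
Lemma extended_energy_space_separates (p q : M) : p != q ->
  exists2 u, L u & u p != u q.
Proof.
rewrite -mdist_gt0; set d := mdist p q => d0.
have near_iota p' : exists x, mdist p' (iota x) < d / 8.
  have pd : nbhs p' (ball p' (d / 8)) by apply: nbhsx_ballx; rewrite divr_gt0.
  by have [x] := dense_nbhs dense_iota pd; rewrite ballEmdist; exists x.
have [x px] := near_iota p; have [y qy] := near_iota q.
pose r := resistance E c o x y.
have dr : 3 / 4 * d <= r.
  have := metric_triangle p (iota x) q; have := metric_triangle (iota x) (iota y) q.
  rewrite [mdist (iota y) q]metric_sym dist_iota -/r -/d; lra.
have [w [Hw ww wr]] := resistance_peak hG x y.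
have [u [uw uc]] := real_energy_extension Hw.
rewrite ww -/r in uc; rewrite -!uw -/r in wr.
exists u.
  split; last by move: Hw; congr (H _); apply/funext => z; rewrite /= uw.
  apply: holder_continuous uc; have := edot_ge0 hG w; by rewrite ww.
apply/eqP => upq.
have close p' x' : mdist p' (iota x') < d / 8 -> `|u p' - u (iota x')| < r / 2.
  move=> px'; apply: le_lt_trans (uc _ _) _.
  have r0 : 0 < r by lra.
  rewrite -[ltRHS]ger0_norm ?divr_ge0 ?ltW// -sqrtr_sqr ltr_sqrt.
    by have := mulr_gt0 r0 d0; nra.
  by rewrite exprn_gt0// divr_gt0.
have := close _ _ px; have := close _ _ qy; rewrite upq !ltr_norml.
by move=> /andP[? ?] /andP[? ?]; lra.
Qed.

Lemma extended_energy_spaceZ k (u : M -> R) : L u -> L (fun p => k * u p).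
Proof.
move=> [cu Hu]; split; last exact: (real_energy_spaceZ hG k Hu).
by move=> p; apply: cvgM; [exact: cvg_cst | exact: cu].
Qed.

Lemma extended_energy_spaceD (u w : M -> R) : L u -> L w -> L (fun p => u p + w p).
Proof.
move=> [cu Hu] [cw Hw]; split; last exact: (real_energy_spaceD hG Hu Hw).
by move=> p; apply: cvgD; [exact: cu | exact: cw].
Qed.

Lemma extended_energy_space_max (u w : M -> R) :
  L u -> L w -> L (fun p => Num.max (u p) (w p)).
Proof.
move=> [cu Hu] [cw Hw]; split; last exact: (real_energy_space_max hG Hu Hw).
by move=> p; apply: continuous_max; [exact: cu | exact: cw].
Qed.

Lemma extended_energy_space_base (u : M -> R) : L u -> u (iota o) = 0.
Proof. by case=> _ []. Qed.

Lemma extended_energy_space0 : L (fun=> 0).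
Proof.
by split; [move=> p; exact: cvg_cst | exact: (real_energy_space0 E c o)].
Qed.

Hypothesis cptM : compact [set: M].

Lemma extended_energy_spaceM (u w : M -> R) : L u -> L w -> L (fun p => u p * w p).
Proof.
have bounded (v : M -> R) : continuous v -> exists K : R, forall p, `|v p| <= K.
  move=> cv; have /compact_bounded[K [_ vK]] : compact (v @` [set: M]).
    by apply: continuous_compact => //; exact: continuous_subspaceT.
  exists (K + 1) => p; apply: (vK (K + 1)); first by rewrite ltrDl.
  by exists p.
move=> [cu Hu] [cw Hw]; split.
  by move=> p; apply: cvgM; [exact: cu | exact: cw].
have [K uK] := bounded u cu; have [K' wK] := bounded w cw.
apply: (real_energy_spaceM hG (K := Num.max K K')) Hu Hw _ _ => x /=.
  by rewrite le_max uK.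
by rewrite le_max wK orbT.
Qed.

(** For [f p] nonzero and distinct from [f q], a multiple of [f * (f - f q)]
    takes the value [t] at [p] and vanishes at [q]. *)
Lemma extended_energy_space_bump (p q : M) (t : R) :
  p != q -> p != iota o -> exists u, [/\ L u, u p = t & u q = 0].
Proof.
move=> pq po.
(* [f] separates [p] both from [q] and from the base point, where it vanishes. *)
have [f Lf [fpq fp0]] : exists2 f, L f & f p != f q /\ f p != 0.
  have [f Lf fpq] := extended_energy_space_separates pq.
  have [fp0|] := eqVneq (f p) 0; last by exists f.
  have [h Lh] := extended_energy_space_separates po.
  rewrite (extended_energy_space_base Lh) => hp0.
  have [hpq|] := eqVneq (h p) (h q); last by exists h.
  exists (fun z => f z + h z); first exact: extended_energy_spaceD.
  rewrite fp0 add0r; split=> //.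
  by rewrite hpq -[X in X != _]add0r (inj_eq (addIr _)) -fp0.
have LfB := extended_energy_spaceD (extended_energy_spaceM Lf Lf)
  (extended_energy_spaceZ (- f q) Lf).
exists (fun z => t / (f p * (f p - f q)) * (f z * f z + - f q * f z)); split.
- exact: extended_energy_spaceZ LfB.
- by field; rewrite subr_eq0 fpq fp0.
- by ring.
Qed.

(** Values at two points can be prescribed, subject to the value 0 at the base
    point. *)
Lemma extended_energy_space_interpolation (g : M -> R) (p q : M) :
  g (iota o) = 0 -> exists u, [/\ L u, u p = g p & u q = g q].
Proof.
move=> go.
have bump x y : x != y -> exists u, [/\ L u, u x = g x & u y = 0].
  move=> xy; have [->|xo] := eqVneq x (iota o); last first.
    exact: extended_energy_space_bump.
  by exists (fun=> 0); split; rewrite ?go//; exact: extended_energy_space0.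
have [<-|pq] := eqVneq p q.
  have [->|po] := eqVneq p (iota o).
    by exists (fun=> 0); rewrite go; split => //; exact: extended_energy_space0.
  by have [u [Lu up _]] := bump _ _ po; exists u.
have [u [Lu up uq]] := bump _ _ pq.
have [w [Lw wq wp]] : exists w, [/\ L w, w q = g q & w p = 0].
  by apply: bump; rewrite eq_sym.
exists (fun z => u z + w z); split; first exact: extended_energy_spaceD.
  by rewrite up wp addr0.
by rewrite uq wq add0r.
Qed.

Lemma extended_energy_space_dense (g : M -> R) (e : R) : 0 < e ->
  continuous g -> g (iota o) = 0 -> exists2 u, L u & forall p, `|u p - g p| < e.
Proof.
move=> e0 cg go; apply: (kakutani_stone cptM (iota o) e0) cg _ _ _.
- by move=> u [].
- exact: extended_energy_space_max.
- move=> u /(extended_energy_spaceZ (-1)).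
  by congr (L _); apply/funext => p; rewrite mulN1r.
- by move=> p q; exact: extended_energy_space_interpolation.
Qed.

(** The inclusion from left to right holds because continuity and vanishing at
    the base point survive uniform limits; for the converse, the real and
    imaginary parts are approximated separately. *)
Lemma energy_extension_dense :
  closure (extension_set iota HC : set {uniform M -> R[i]^o}) =
  [set g : M -> R[i]^o | continuous g /\ g (iota o) = 0].
Proof.
apply/seteqP; split=> [g /closure_uniformP clg|g [cg go]].
  have approx e : 0 < e -> exists h : M -> R[i]^o,
      [/\ continuous h, h (iota o) = 0 & forall p, normc (g p - h p) < e].
    move=> e0; have [h [f Hf hf] gh] := clg e e0; exists h.
    have [ft [ftf cft]] := energy_extension Hf.
    rewrite (extends_by_closure_unique hf ftf).
    split=> //; [exact: unif_continuous_continuous| |].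
      by case: ftf => -> _; case: Hf.
    by rewrite -(extends_by_closure_unique hf ftf).
  split.
    move=> p A /complex_nbhsP[e e0 eA].
    have e3 : 0 < e / 3 by rewrite divr_gt0.
    have [h [ch _ gh]] := approx _ e3.
    have : nbhs p [set q | normc (h p - h q) < e / 3].
      apply: (ch p [set z | normc (h p - z) < e / 3]).
      by apply/complex_nbhsP; exists (e / 3).
    apply: filterS => q /= hpq; apply: eA => /=.
    rewrite (_ : g p - g q = (g p - h p) + ((h p - h q) - (g q - h q))); last by ring.
    have := le_normcD (g p - h p) ((h p - h q) - (g q - h q)).
    have := le_normcD (h p - h q) (- (g q - h q)).
    have := gh p; have := gh q; rewrite normcN; lra.
  apply: eq0_normc; apply/eqP; rewrite eq_le; apply/andP; split; last first.
    by case: (g _) => a b; exact: sqrtr_ge0.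
  apply/ler_addgt0Pl => e e0; rewrite addr0.
  by have [h [_ ho /(_ (iota o))]] := approx e e0; rewrite ho subr0 => /ltW.
apply/closure_uniformP => e e0; have e2 : 0 < e / 2 by rewrite divr_gt0.
have cvg_part (P : R[i] -> R) : (forall z z', `|P z - P z'| <= normc (z - z')) ->
    continuous (P \o g).
  move=> PN p; apply/cvgrPdist_lt => d d0.
  have : nbhs p [set q | normc (g p - g q) < d].
    apply: (cg p [set z | normc (g p - z) < d]).
    by apply/complex_nbhsP; exists d.
  by apply: filterS => q /=; exact: le_lt_trans.
have [a [ca Ha] ga] : exists2 u, L u & forall p, `|u p - complex.Re (g p)| < e / 2.
  apply: (extended_energy_space_dense (g := fun p => complex.Re (g p))) => //.
    by apply: (cvg_part (@complex.Re R)) => z z'; rewrite -complex_ReB Re_le_normc.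
  by rewrite go.
have [b [cb Hb] gb] : exists2 u, L u & forall p, `|u p - complex.Im (g p)| < e / 2.
  apply: (extended_energy_space_dense (g := fun p => complex.Im (g p))) => //.
    by apply: (cvg_part (@complex.Im R)) => z z'; rewrite -complex_ImB Im_le_normc.
  by rewrite go.
pose h p : R[i]^o := Complex (a p) (b p).
have gh p : normc (g p - h p) < e.
  apply: le_lt_trans (normc_le_ReIm _) _; rewrite (splitr e).
  have -> : complex.Re (g p - h p) = complex.Re (g p) - a p by exact: complex_ReB.
  have -> : complex.Im (g p - h p) = complex.Im (g p) - b p by exact: complex_ImB.
  by apply: ltrD; rewrite distrC.
exists h => //; exists (h \o iota).
  by apply/(energy_spaceP hG).
apply: (continuous_extends_by_closure dense_iota) => [|x]; last by [].
exact: complex_continuous.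
Qed.

End completion.

Theorem theorem4p13 (R : realType) (V : countType) (E : rel V)
    (c : V -> V -> R) (o : V) (hG : network E c o)
    (M : metricType R) (iota : V -> M)
    (hM : is_completion (resistance E c o) iota) :
  [/\ forall f : V -> R[i], energy_space E c o f ->
        exists ft : M -> R[i]^o,
          extends_by_closure iota f ft /\ unif_continuous ft,
      (exists B : R, forall x y : V, resistance E c o x y <= B) ->
        pointwise_algebra (energy_space E c o) &
      compact [set: M] ->
        closure (extension_set iota (energy_space E c o)
                 : set {uniform M -> R[i]^o})
        = [set g : M -> R[i]^o | continuous g /\ g (iota o) = 0] ].
Proof.
split=> [f Hf|bounded_res|cptM].
- exact: (energy_extension hG hM).
- exact: energy_space_algebra hG bounded_res.
- exact: energy_extension_dense.
Qed.
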